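(* Let $K$ be a field and let $E$ and $F$ be row-finite graphs such that $L_K(E)\cong L_K(F)$ as rings. Then, for every nonnegative integer $n$, $E$ has exactly $n$ different isolated loops if and only if $F$ has exactly $n$ different isolated loops.
   Context: A (directed) graph $E=(E^0,E^1,r,s)$ consists of sets $E^0$ (vertices), $E^1$ (edges) and maps $r,s:E^1\to E^0$ (range, source); it is row-finite if $s^{-1}(v)$ is finite for every $v\in E^0$. A sink is a vertex emitting no edges. An isolated loop (based at a vertex $u$) is an edge $f$ with $s(f)=r(f)=u$ such that no other edge of the graph has source or range $u$. The Leavitt path algebra $L_K(E)$ is the $K$-algebra generated by $E^0\cup E^1\cup\{e^*\mid e\in E^1\}$ with relations: $vw=\delta_{v,w}v$ for $v,w\in E^0$; $s(e)e=er(e)=e$ and $r(e)e^*=e^*s(e)=e^*$ for $e\in E^1$; $e^*f=\delta_{e,f}r(e)$ for $e,f\in E^1$; $v=\sum_{e\in s^{-1}(v)}ee^*$ for every $v\in E^0$ that is not a sink. *)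

(* Defs.v *)
From HB Require Import structures.
From mathcomp Require Import all_boot all_order all_algebra.
From mathcomp Require Import boolp classical_sets functions cardinality.

Set Implicit Arguments.
Unset Strict Implicit.
Unset Printing Implicit Defensive.

Import GRing.Theory.
Local Open Scope ring_scope.
Local Open Scope quotient_scope.
Local Open Scope classical_set_scope.

(* Associative rings without a required unit: L_K(E) is unital only when E
   has finitely many vertices. *)
HB.mixin Record Zmodule_isRng R of GRing.Zmodule R := {
  rmul : R -> R -> R;
  rmulA : associative rmul;
  rmulDl : left_distributive rmul +%R;
  rmulDr : right_distributive rmul +%R
}.

#[short(type="rngType")]
HB.structure Definition Rng := {R of Zmodule_isRng R & GRing.Zmodule R}.

Definition rng_isomorphic (A B : rngType) : Prop :=
  exists f : A -> B,
    [/\ bijective f, {morph f : x y / x + y} & {morph f : x y / rmul x y}].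

Record digraph := Digraph {
  vertex : Type;
  edge : Type;
  esource : edge -> vertex;
  erange : edge -> vertex
}.

Definition row_finite (E : digraph) : Prop :=
  forall v : vertex E, finite_set [set e : edge E | esource e = v].

Definition is_sink (E : digraph) (v : vertex E) : Prop :=
  ~ exists e : edge E, esource e = v.

Definition isolated_loop (E : digraph) (f : edge E) : Prop :=
  exists u : vertex E,
    [/\ esource f = u, erange f = u &
        forall g : edge E, esource g = u \/ erange g = u -> g = f].

(* Nonunital K-algebra expressions in the generators v, e, e^*. *)
Inductive lterm (K : Type) (E : digraph) : Type :=
  | LVertex of vertex E
  | LEdge of edge E
  | LGhost of edge E
  | LZero
  | LOpp of lterm K E
  | LAdd of lterm K E & lterm K E
  | LMul of lterm K E & lterm K E
  | LScale of K & lterm K E.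

Arguments LVertex {K E}.
Arguments LEdge {K E}.
Arguments LGhost {K E}.
Arguments LZero {K E}.

Definition lsum (K : Type) (E : digraph) (ts : seq (lterm K E)) : lterm K E :=
  foldr (@LAdd K E) LZero ts.

(* The least congruence containing the K-algebra axioms and the defining
   relations of L_K(E). *)
Inductive lcong (K : fieldType) (E : digraph) :
    lterm K E -> lterm K E -> Prop :=
  | lcong_refl t : lcong t t
  | lcong_sym t u : lcong t u -> lcong u t
  | lcong_trans t u w : lcong t u -> lcong u w -> lcong t w
  | lcong_opp t t' : lcong t t' -> lcong (LOpp t) (LOpp t')
  | lcong_add t t' u u' :
      lcong t t' -> lcong u u' -> lcong (LAdd t u) (LAdd t' u')
  | lcong_mul t t' u u' :
      lcong t t' -> lcong u u' -> lcong (LMul t u) (LMul t' u')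
  | lcong_scale a t t' : lcong t t' -> lcong (LScale a t) (LScale a t')
  | lcong_addA t u w : lcong (LAdd t (LAdd u w)) (LAdd (LAdd t u) w)
  | lcong_addC t u : lcong (LAdd t u) (LAdd u t)
  | lcong_add0 t : lcong (LAdd LZero t) t
  | lcong_addN t : lcong (LAdd (LOpp t) t) LZero
  | lcong_mulA t u w : lcong (LMul t (LMul u w)) (LMul (LMul t u) w)
  | lcong_mulDl t u w :
      lcong (LMul (LAdd t u) w) (LAdd (LMul t w) (LMul u w))
  | lcong_mulDr t u w :
      lcong (LMul t (LAdd u w)) (LAdd (LMul t u) (LMul t w))
  | lcong_scaleA a b t : lcong (LScale a (LScale b t)) (LScale (a * b) t)
  | lcong_scale1 t : lcong (LScale 1 t) t
  | lcong_scaleDr a t u :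
      lcong (LScale a (LAdd t u)) (LAdd (LScale a t) (LScale a u))
  | lcong_scaleDl a b t :
      lcong (LScale (a + b) t) (LAdd (LScale a t) (LScale b t))
  | lcong_scaleAl a t u : lcong (LScale a (LMul t u)) (LMul (LScale a t) u)
  | lcong_scaleAr a t u : lcong (LScale a (LMul t u)) (LMul t (LScale a u))
  | lcong_vv v : lcong (LMul (LVertex v) (LVertex v)) (LVertex v)
  | lcong_vw v w : v <> w -> lcong (LMul (LVertex v) (LVertex w)) LZero
  | lcong_se e : lcong (LMul (LVertex (esource e)) (LEdge e)) (LEdge e)
  | lcong_er e : lcong (LMul (LEdge e) (LVertex (erange e))) (LEdge e)
  | lcong_rg e : lcong (LMul (LVertex (erange e)) (LGhost e)) (LGhost e)
  | lcong_gs e : lcong (LMul (LGhost e) (LVertex (esource e))) (LGhost e)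
  | lcong_gee e : lcong (LMul (LGhost e) (LEdge e)) (LVertex (erange e))
  | lcong_gef e f : e <> f -> lcong (LMul (LGhost e) (LEdge f)) LZero
  (* [es] enumerates s^{-1}(v) without repetition *)
  | lcong_ck2 v (es : seq {classic edge E}) :
      ~ is_sink v -> uniq es -> (forall e, e \in es <-> esource e = v) ->
      lcong (LVertex v)
              (lsum [seq LMul (LEdge (e : edge E)) (LGhost e) | e <- es]).

HB.instance Definition _ (K : Type) (E : digraph) :=
  gen_eqMixin (lterm K E).
HB.instance Definition _ (K : Type) (E : digraph) :=
  gen_choiceMixin (lterm K E).

Definition lcongb (K : fieldType) (E : digraph) : rel (lterm K E) :=
  fun t u => `[< lcong t u >].

Lemma lcongb_refl (K : fieldType) (E : digraph) : reflexive (@lcongb K E).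
Proof. by move=> t; apply/asboolP; exact: lcong_refl. Qed.

Lemma lcongb_sym (K : fieldType) (E : digraph) : symmetric (@lcongb K E).
Proof. by move=> t u; apply/asboolP/asboolP; exact: lcong_sym. Qed.

Lemma lcongb_trans (K : fieldType) (E : digraph) : transitive (@lcongb K E).
Proof.
by move=> u t w /asboolP tu /asboolP uw; apply/asboolP; exact: lcong_trans tu uw.
Qed.

Canonical lcongb_equiv (K : fieldType) (E : digraph) :=
  EquivRel (@lcongb K E) (@lcongb_refl K E) (@lcongb_sym K E) (@lcongb_trans K E).

Definition leavitt (K : fieldType) (E : digraph) : Type :=
  {eq_quot @lcongb K E}.

HB.instance Definition _ (K : fieldType) (E : digraph) :=
  Choice.on (leavitt K E).
HB.instance Definition _ (K : fieldType) (E : digraph) :=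
  EqQuotient.on (leavitt K E).

Section LeavittPathAlgebra.
Variables (K : fieldType) (E : digraph).
Notation L := (leavitt K E).
Implicit Types (t u : lterm K E) (x y z : L) (a b : K).

Lemma leavittP t u : \pi_L t = \pi_L u <-> lcong t u.
Proof.
by split=> [/eqmodP/asboolP|tu] //; apply/eqmodP/asboolP.
Qed.

Lemma lcong_repr t : lcong (repr (\pi_L t)) t.
Proof. by apply/leavittP; rewrite reprK. Qed.

Definition lzero : L := lift_cst L LZero.
Definition lopp : L -> L := lift_op1 L (@LOpp K E).
Definition ladd : L -> L -> L := lift_op2 L (@LAdd K E).
Definition lmul : L -> L -> L := lift_op2 L (@LMul K E).
Definition lscale a : L -> L := lift_op1 L (LScale a).

Lemma pi_lzero : lzero = \pi_L LZero.
Proof. by rewrite /lzero -lock. Qed.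

Lemma pi_lopp t : lopp (\pi_L t) = \pi_L (LOpp t).
Proof. by rewrite /lopp -lock; apply/leavittP/lcong_opp/lcong_repr. Qed.

Lemma pi_ladd t u : ladd (\pi_L t) (\pi_L u) = \pi_L (LAdd t u).
Proof.
by rewrite /ladd -lock; apply/leavittP/lcong_add; exact: lcong_repr.
Qed.

Lemma pi_lmul t u : lmul (\pi_L t) (\pi_L u) = \pi_L (LMul t u).
Proof.
by rewrite /lmul -lock; apply/leavittP/lcong_mul; exact: lcong_repr.
Qed.

Lemma pi_lscale a t : lscale a (\pi_L t) = \pi_L (LScale a t).
Proof. by rewrite /lscale -lock; apply/leavittP/lcong_scale/lcong_repr. Qed.

Definition pi_lE := (pi_lzero, pi_lopp, pi_ladd, pi_lmul, pi_lscale).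

Lemma laddA : associative ladd.
Proof.
elim/quotW=> t; elim/quotW=> u; elim/quotW=> w.
by rewrite !pi_lE; apply/leavittP/lcong_addA.
Qed.

Lemma laddC : commutative ladd.
Proof.
by elim/quotW=> t; elim/quotW=> u; rewrite !pi_lE; apply/leavittP/lcong_addC.
Qed.

Lemma ladd0 : left_id lzero ladd.
Proof. by elim/quotW=> t; rewrite !pi_lE; apply/leavittP/lcong_add0. Qed.

Lemma laddN : left_inverse lzero lopp ladd.
Proof. by elim/quotW=> t; rewrite !pi_lE; apply/leavittP/lcong_addN. Qed.

HB.instance Definition _ := GRing.isZmodule.Build L laddA laddC ladd0 laddN.

Lemma lmulA : associative lmul.
Proof.
elim/quotW=> t; elim/quotW=> u; elim/quotW=> w.
by rewrite !pi_lE; apply/leavittP/lcong_mulA.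
Qed.

Lemma lmulDl : left_distributive lmul (+%R : L -> L -> L).
Proof.
elim/quotW=> t; elim/quotW=> u; elim/quotW=> w.
by rewrite /+%R /= !pi_lE; apply/leavittP/lcong_mulDl.
Qed.

Lemma lmulDr : right_distributive lmul (+%R : L -> L -> L).
Proof.
elim/quotW=> t; elim/quotW=> u; elim/quotW=> w.
by rewrite /+%R /= !pi_lE; apply/leavittP/lcong_mulDr.
Qed.

HB.instance Definition _ := Zmodule_isRng.Build L lmulA lmulDl lmulDr.

Lemma lscaleA a b x : lscale a (lscale b x) = lscale (a * b) x.
Proof. by elim/quotW: x => t; rewrite !pi_lE; apply/leavittP/lcong_scaleA. Qed.

Lemma lscale1 : left_id 1 lscale.
Proof. by elim/quotW=> t; rewrite !pi_lE; apply/leavittP/lcong_scale1. Qed.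

Lemma lscaleDr : right_distributive lscale (+%R : L -> L -> L).
Proof.
move=> a; elim/quotW=> t; elim/quotW=> u.
by rewrite /+%R /= !pi_lE; apply/leavittP/lcong_scaleDr.
Qed.

Lemma lscaleDl x : {morph lscale^~ x : a b / a + b >-> a + b}.
Proof.
move=> a b; elim/quotW: x => t.
by rewrite [RHS]/+%R /= !pi_lE; apply/leavittP/lcong_scaleDl.
Qed.

HB.instance Definition _ :=
  GRing.Zmodule_isLmodule.Build K L lscaleA lscale1 lscaleDr lscaleDl.

Lemma lscaleAl a x y : a *: rmul x y = rmul (a *: x) y.
Proof.
elim/quotW: x => t; elim/quotW: y => u.
by rewrite /rmul /*:%R /= !pi_lE; apply/leavittP/lcong_scaleAl.
Qed.

Lemma lscaleAr a x y : a *: rmul x y = rmul x (a *: y).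
Proof.
elim/quotW: x => t; elim/quotW: y => u.
by rewrite /rmul /*:%R /= !pi_lE; apply/leavittP/lcong_scaleAr.
Qed.

End LeavittPathAlgebra.

(* Main.v *)
(* An isolated loop based at [u] makes [u] a central idempotent with
   [u L = K[x, x^-1]].  We count isolated loops ring-theoretically, as the
   nonzero central idempotents [e] for which [e L] is a domain that is not a
   division ring.  Conversely, let [e] be such an idempotent.  It lies under a
   single vertex [v], since the elements [e w] are orthogonal idempotents of the
   domain [e L].  Centrality forces every edge entering [v] to start at [v], and
   the domain property leaves at most one loop at [v].  If [v] is a sink then
   [e L = K e], which is excluded.  Otherwise there is a loop [f] at [v], and an
   exit [g <> f] satisfies [e g = 0]; as [f] is the only edge entering [v], some
   [f*^N e] is a polynomial in [f*], which [e f^k g = 0] forces to vanish,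
   whence [e = 0].  So [f] is isolated, and [e = v] since [v L] is a domain. *)
Require Import Defs.
From HB Require Import structures.
From mathcomp Require Import all_boot all_order all_algebra.
From mathcomp Require Import boolp classical_sets functions cardinality.

Set Implicit Arguments.
Unset Strict Implicit.
Unset Printing Implicit Defensive.

Import GRing.Theory.
Local Open Scope quotient_scope.
Local Open Scope ring_scope.

(* A unit is adjoined so that polynomials can be evaluated at elements of [L]. *)
Definition unitization (K : fieldType) (E : digraph) : Type :=
  (K^o * leavitt K E)%type.

(** * Unitization and the defining relations *)

Section Unitization.
Variables (K : fieldType) (E : digraph).
Notation L := (leavitt K E).
Notation A := (unitization K E).
Implicit Types (a b c : A) (x y : L) (k : K).

HB.instance Definition _ := GRing.Lmodule.copy A (K^o * L)%type.

(** A pair [(k, x)] stands for the sum [k + x]; this is the expanded product of two such sums. *)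
Definition umul a b : A :=
  ((a.1 : K) * b.1, (a.1 : K) *: b.2 + (b.1 : K) *: a.2 + rmul a.2 b.2).
Definition uone : A := (1, 0).

Lemma rmul0r x : rmul 0 x = 0 :> L.
Proof. by apply: (addrI (rmul 0 x)); rewrite -rmulDl !addr0. Qed.

Lemma rmulr0 x : rmul x 0 = 0 :> L.
Proof. by apply: (addrI (rmul x 0)); rewrite -rmulDr !addr0. Qed.

Lemma umulA : associative umul.
Proof.
move=> [p x] [q y] [r z]; congr pair; first exact: mulrA.
rewrite /= !scalerDr !rmulDl !rmulDr !scalerA -!lscaleAl -!lscaleAr -!rmulA.
rewrite (mulrC q r) (mulrC p r) -!addrA; congr (_ + _).
congr (_ + _); rewrite [LHS]addrCA; congr (_ + _).
by rewrite [RHS]addrCA; congr (_ + _); exact: addrCA.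
Qed.

Lemma umul1 : left_id uone umul.
Proof.
move=> [p x]; congr pair; first exact: mul1r.
by rewrite /= rmul0r scaler0 scale1r !addr0.
Qed.

Lemma umulr1 : right_id uone umul.
Proof.
move=> [p x]; congr pair; first exact: mulr1.
by rewrite /= rmulr0 scaler0 scale1r addr0 add0r.
Qed.

Lemma umulDl : left_distributive umul +%R.
Proof.
move=> [p x] [q y] [r z]; congr pair; first exact: mulrDl.
rewrite /= scalerDl scalerDr rmulDl !addrA; congr (_ + _).
rewrite -!addrA; congr (_ + _).
by rewrite addrCA; congr (_ + _); rewrite addrA addrC.
Qed.

Lemma umulDr : right_distributive umul +%R.
Proof.
move=> [p x] [q y] [r z]; congr pair; first exact: mulrDr.
rewrite /= scalerDl scalerDr rmulDr !addrA; congr (_ + _).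
rewrite -!addrA; congr (_ + _); rewrite addrCA; congr (_ + _).
by rewrite addrA addrC.
Qed.

Lemma uone_neq0 : uone != 0.
Proof. by apply/eqP => -[/eqP]; rewrite oner_eq0. Qed.

HB.instance Definition _ :=
  GRing.Zmodule_isNzRing.Build A umulA umul1 umulr1 umulDl umulDr uone_neq0.

Lemma uscaleAl k a b : k *: (a * b) = (k *: a) * b.
Proof.
case: a b => [p x] [q y]; congr pair; first exact: mulrA.
by rewrite /= !scalerDr !scalerA lscaleAl (mulrC q).
Qed.

HB.instance Definition _ := GRing.Lmodule_isLalgebra.Build K A uscaleAl.

Lemma uscaleAr k a b : k *: (a * b) = a * (k *: b).
Proof.
case: a b => [p x] [q y]; congr pair; first exact: mulrCA.
by rewrite /= !scalerDr !scalerA lscaleAr (mulrC p).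
Qed.

HB.instance Definition _ := GRing.Lalgebra_isAlgebra.Build K A uscaleAr.

Definition embed x : A := (0, x).

Lemma embed_inj : injective embed. Proof. by move=> x y []. Qed.

Lemma embedD x y : embed (x + y) = embed x + embed y.
Proof. by congr pair; rewrite addr0. Qed.

Lemma embedM x y : embed (rmul x y) = embed x * embed y.
Proof. by congr pair; rewrite /= ?mul0r // !scale0r !add0r. Qed.

Lemma embedZ k x : embed (k *: x) = k *: embed x.
Proof. by congr pair; rewrite /= scaler0. Qed.

Lemma embed0 : embed 0 = 0. Proof. by []. Qed.

Lemma embedN x : embed (- x) = - embed x.
Proof. by congr pair; rewrite /= oppr0. Qed.

Lemma embed_eq0 x : embed x = 0 -> x = 0. Proof. by case. Qed.

Lemma unitizationE a : a = (a.1 : K)%:A + embed a.2.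
Proof.
case: a => k x; congr pair; rewrite /=.
  by rewrite [k *: 1]mulr1 addr0.
by rewrite scaler0 add0r.
Qed.

Lemma comm_unitization x a : (forall y, rmul x y = rmul y x) ->
  embed x * a = a * embed x.
Proof.
move=> xC; rewrite [a]unitizationE mulrDr mulrDl -!embedM xC.
by rewrite -scalerAl -scalerAr mul1r mulr1.
Qed.

Definition vtx (v : vertex E) : A := embed (\pi_L (LVertex v)).
Definition edg (e : edge E) : A := embed (\pi_L (LEdge e)).
Definition gho (e : edge E) : A := embed (\pi_L (LGhost e)).

Lemma pi_add t u : \pi_L (LAdd t u) = \pi_L t + \pi_L u.
Proof. by rewrite -pi_ladd. Qed.
Lemma pi_mul t u : \pi_L (LMul t u) = rmul (\pi_L t) (\pi_L u).
Proof. by rewrite -pi_lmul. Qed.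
Lemma pi_scale k t : \pi_L (LScale k t) = k *: \pi_L t.
Proof. by rewrite -pi_lscale. Qed.
Lemma pi_zero : \pi_L LZero = 0.
Proof. by rewrite -pi_lzero. Qed.
Lemma pi_opp t : \pi_L (LOpp t) = - \pi_L t.
Proof. by rewrite -pi_lopp. Qed.

(** Elements of [L] are classes of terms in the generators, so induction on a representative
    suffices; opposites are scalings by [-1]. *)
Lemma leavitt_ind (P : A -> Prop) :
    (forall v, P (vtx v)) -> (forall e, P (edg e)) -> (forall e, P (gho e)) ->
    P 0 -> (forall a b, P a -> P b -> P (a + b)) ->
    (forall x y, P (embed x) -> P (embed y) -> P (embed x * embed y)) ->
    (forall k a, P a -> P (k *: a)) ->
  forall x, P (embed x).
Proof.
move=> Pv Pe Pg P0 PD PM PZ; elim/quotW; elim=> //=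
  [|t|t Pt u Pu|t Pt u Pu|k t].
- by rewrite pi_zero.
- by rewrite pi_opp embedN -scaleN1r; apply: PZ.
- by rewrite pi_add embedD; apply: PD.
- by rewrite pi_mul embedM; apply: PM.
- by rewrite pi_scale embedZ; apply: PZ.
Qed.

Lemma embed_pi_cong t u : lcong t u -> embed (\pi_L t) = embed (\pi_L u).
Proof. by move/leavittP->. Qed.

Lemma vtxM v : vtx v * vtx v = vtx v.
Proof. by rewrite -embedM -pi_mul; apply/embed_pi_cong/lcong_vv. Qed.

Lemma vtxM0 v w : v <> w -> vtx v * vtx w = 0.
Proof.
move=> vw; rewrite -embedM -pi_mul -embed0 -pi_zero.
by apply/embed_pi_cong/lcong_vw.
Qed.

Lemma source_edg e : vtx (esource e) * edg e = edg e.
Proof. by rewrite -embedM -pi_mul; apply/embed_pi_cong/lcong_se. Qed.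

Lemma edg_range e : edg e * vtx (erange e) = edg e.
Proof. by rewrite -embedM -pi_mul; apply/embed_pi_cong/lcong_er. Qed.

Lemma range_gho e : vtx (erange e) * gho e = gho e.
Proof. by rewrite -embedM -pi_mul; apply/embed_pi_cong/lcong_rg. Qed.

Lemma gho_source e : gho e * vtx (esource e) = gho e.
Proof. by rewrite -embedM -pi_mul; apply/embed_pi_cong/lcong_gs. Qed.

Lemma gho_edg e : gho e * edg e = vtx (erange e).
Proof. by rewrite -embedM -pi_mul; apply/embed_pi_cong/lcong_gee. Qed.

Lemma gho_edg0 e f : e <> f -> gho e * edg f = 0.
Proof.
move=> ef; rewrite -embedM -pi_mul -embed0 -pi_zero.
by apply/embed_pi_cong/lcong_gef.
Qed.

Lemma cuntz_krieger2 v (es : seq {classic edge E}) :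
    ~ is_sink v -> uniq es -> (forall e, e \in es <-> esource e = v) ->
  vtx v = \sum_(e <- es) edg e * gho e.
Proof.
move=> vs ues esP; have /embed_pi_cong := @lcong_ck2 K E v es vs ues esP.
rewrite -/(vtx v) => ->; elim: es {vs ues esP} => [|e es IH] /=.
  by rewrite big_nil pi_zero.
by rewrite big_cons pi_add embedD IH pi_mul embedM.
Qed.

Lemma vtx_edg0 v e : v <> esource e -> vtx v * edg e = 0.
Proof. by move=> /vtxM0 ve; rewrite -source_edg mulrA ve mul0r. Qed.

Lemma edg_vtx0 v e : erange e <> v -> edg e * vtx v = 0.
Proof. by move=> /vtxM0 ve; rewrite -edg_range -mulrA ve mulr0. Qed.

Lemma vtx_gho0 v e : v <> erange e -> vtx v * gho e = 0.
Proof. by move=> /vtxM0 ve; rewrite -range_gho mulrA ve mul0r. Qed.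

Lemma gho_vtx0 v e : esource e <> v -> gho e * vtx v = 0.
Proof. by move=> /vtxM0 ve; rewrite -gho_source -mulrA ve mulr0. Qed.

End Unitization.

(** * A representation with nonzero vertices *)

(* [L] acts on the functions on [vertex E * nat * int].  The number [m] over a
   vertex [v] codes a path from [v] in base [size (out v)]: its last digit is
   the index of the first edge, and the quotient codes the rest of the path.
   The integer records the degree, and separates the powers of a ghost loop. *)
Section BoundaryRepresentation.
Variables (K : fieldType) (E : digraph).
Variable out : vertex E -> seq {classic edge E}.
Hypothesis out_uniq : forall v, uniq (out v).
Hypothesis mem_out : forall v e, e \in out v <-> esource e = v.
Notation L := (leavitt K E).
Notation A := (unitization K E).

Let point := (vertex E * nat * int)%type.
Implicit Types (phi psi : point -> K) (p : point) (t u : lterm K E).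

Let deg e := size (out (esource e)).
Let rank e := index (e : {classic edge E}) (out (esource e)).

(** Operators act by pullback: [LEdge e] reads [phi] at the path with its first edge [e] deleted,
    [LGhost e] at the path with [e] prepended. *)
Fixpoint act t phi p : K :=
  match t with
  | LVertex v => if `[< p.1.1 = v >] then phi p else 0
  | LEdge e =>
      if `[< p.1.1 = esource e >] && (p.1.2 %% deg e == rank e)%N
      then phi (erange e, (p.1.2 %/ deg e)%N, p.2 - 1) else 0
  | LGhost e =>
      if `[< p.1.1 = erange e >]
      then phi (esource e, (p.1.2 * deg e + rank e)%N, p.2 + 1) else 0
  | LZero => 0
  | LOpp t => - act t phi p
  | LAdd t u => act t phi p + act u phi p
  | LMul t u => act t (act u phi) p
  | LScale k t => k * act t phi p
  end.

Lemma actD t phi psi p :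
  act t (fun q => phi q + psi q) p = act t phi p + act t psi p.
Proof.
elim: t phi psi p => /= [v|e|e||t IH|t IHt u IHu|t IHt u IHu|k t IH] phi psi p.
- by case: ifP; rewrite ?addr0.
- by case: ifP; rewrite ?addr0.
- by case: ifP; rewrite ?addr0.
- by rewrite addr0.
- by rewrite IH opprD.
- by rewrite IHt IHu addrACA.
- by rewrite -IHt; congr act; apply/funext => q; rewrite IHu.
- by rewrite IH mulrDr.
Qed.

Lemma actZ t k phi p : act t (fun q => k * phi q) p = k * act t phi p.
Proof.
elim: t phi p => /= [v|e|e||t IH|t IHt u IHu|t IHt u IHu|l t IH] phi p.
- by case: ifP; rewrite ?mulr0.
- by case: ifP; rewrite ?mulr0.
- by case: ifP; rewrite ?mulr0.
- by rewrite mulr0.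
- by rewrite IH mulrN.
- by rewrite IHt IHu mulrDr.
- by rewrite -IHt; congr act; apply/funext => q; rewrite IHu.
- by rewrite IH mulrCA.
Qed.

Lemma mem_out_source e : (e : {classic edge E}) \in out (esource e).
Proof. exact/mem_out. Qed.

Lemma rank_lt e : (rank e < deg e)%N.
Proof. by rewrite index_mem mem_out_source. Qed.

Lemma deg_gt0 e : (0 < deg e)%N. Proof. exact: leq_ltn_trans (rank_lt e). Qed.

Lemma rank_inj e f : esource e = esource f -> rank e = rank f -> e = f.
Proof.
move=> ef; have := mem_out_source f; rewrite /rank -ef => fout.
exact: (index_inj _ (mem_out_source e)).
Qed.

Lemma act_lsum (es : seq {classic edge E}) phi p :
  act (lsum [seq LMul (LEdge (e : edge E)) (LGhost e) | e <- es]) phi p =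
  \sum_(e <- es) act (LMul (LEdge e) (LGhost e)) phi p.
Proof. by elim: es => [|e es IH] /=; rewrite ?big_nil ?big_cons ?IH. Qed.

Lemma act_edge_ghost e phi p : act (LMul (LEdge e) (LGhost e)) phi p =
  if `[< p.1.1 = esource e >] && (p.1.2 %% deg e == rank e)%N
  then phi p else 0.
Proof.
case: p => [[w m] d] /=; case: ifP => // /andP[/asboolP -> /eqP <-].
by rewrite (asboolT erefl) // -divn_eq subrK.
Qed.

Lemma act_ck2 v (es : seq {classic edge E}) phi p :
    ~ is_sink v -> uniq es -> (forall e, e \in es <-> esource e = v) ->
  act (LVertex v) phi p =
  act (lsum [seq LMul (LEdge (e : edge E)) (LGhost e) | e <- es]) phi p.
Proof.
move=> /contrapT[e0 e0v] ues esP; rewrite act_lsum.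
under eq_bigr do rewrite act_edge_ghost.
case: p => [[w m] d] /=; case: asboolP => [->|wv]; last first.
  rewrite big1_seq // => e /andP[_ /esP ev]; rewrite asboolF // ev.
  exact: wv.
have nv : (0 < size (out v))%N by have := deg_gt0 e0; rewrite /deg e0v.
(* The last digit of [m] names the first edge of the path, so the summand of this edge alone
   survives. *)
pose e := nth (e0 : {classic edge E}) (out v) (m %% size (out v))%N.
have ev : esource e = v by apply/mem_out/mem_nth; rewrite ltn_mod.
have re : (m %% deg e)%N = rank e.
  by rewrite /deg /rank ev index_uniq // ltn_mod.
rewrite (bigD1_seq e) //=; last by apply/esP.
rewrite ev (asboolT erefl) // re eqxx /= big1_seq ?addr0 // => f.
move=> /andP[fe /esP fv].
case: eqP => [r|_]; last by rewrite andbF.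
case/eqP: fe; apply: rank_inj; first by rewrite fv ev.
by rewrite -r -re /deg fv ev.
Qed.

(** For equal sources, prepending [e] makes the last digit [rank e], which differs from [rank f];
    for distinct sources the vertex test already fails. *)
Lemma act_gef e f phi p :
  e <> f -> act (LMul (LGhost e) (LEdge f)) phi p = 0.
Proof.
move=> ef; case: p => [[w m] d] /=; case: asboolP => // _.
case: asboolP => //= sef; case: eqP => // r; case: ef; apply: rank_inj => //.
have dd : deg f = deg e by rewrite /deg sef.
by move: r; rewrite dd modnMDl modn_small ?rank_lt.
Qed.

Lemma act_cong t u : lcong t u -> act t = act u.
Proof.
elim=> {t u} //.
- by move=> t u w _ -> _ ->.
- by move=> t t' _ IH; apply/funext => phi; apply/funext => p /=; rewrite IH.
- move=> t t' u u' _ IH _ IH'.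
  by apply/funext => phi; apply/funext => p /=; rewrite IH IH'.
- move=> t t' u u' _ IH _ IH'.
  by apply/funext => phi; apply/funext => p /=; rewrite IH IH'.
- by move=> k t t' _ IH; apply/funext => phi; apply/funext => p /=; rewrite IH.
all: move=> *; apply/funext => phi; apply/funext => -[[w m] d].
- by rewrite /= addrA.
- by rewrite /= addrC.
- by rewrite /= add0r.
- by rewrite /= addNr.
- by rewrite /= actD.
- by rewrite /= mulrA.
- by rewrite /= mul1r.
- by rewrite /= mulrDr.
- by rewrite /= mulrDl.
- by rewrite /= actZ.
- by rewrite /=; case: asboolP.
- by rewrite /=; case: asboolP => // ->; rewrite asboolF.
- by rewrite /=; case: (asboolP (w = _)).
- by rewrite /= (asboolT erefl).
- by rewrite /=; case: (asboolP (w = _)).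
- by rewrite /= (asboolT erefl); case: ifP.
- rewrite /=; case: asboolP => // ->.
  rewrite (asboolT erefl) //= modnMDl modn_small ?rank_lt // eqxx.
  by rewrite divnMDl ?deg_gt0 // divn_small ?rank_lt // addn0 addrK.
- exact: act_gef.
- exact: act_ck2.
Qed.

Definition rho (a : A) phi p : K := (a.1 : K) * phi p + act (repr a.2) phi p.

Lemma act_repr t : act (repr (\pi_L t)) = act t.
Proof. exact/act_cong/lcong_repr. Qed.

Lemma rho_pi t phi p : rho (embed (\pi_L t)) phi p = act t phi p.
Proof. by rewrite /rho act_repr mul0r add0r. Qed.

Lemma rho0 phi p : rho 0 phi p = 0.
Proof. by rewrite -(@embed0 K E) -pi_zero rho_pi. Qed.

Lemma act_reprD (x y : L) phi p :
  act (repr (x + y)) phi p = act (repr x) phi p + act (repr y) phi p.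
Proof.
by rewrite -[x in x + y]reprK -[y in _ + y]reprK -pi_add act_repr.
Qed.

Lemma act_reprZ k (x : L) phi p :
  act (repr (k *: x)) phi p = k * act (repr x) phi p.
Proof. by rewrite -[x in _ *: x]reprK -pi_scale act_repr. Qed.

Lemma act_reprM (x y : L) phi p :
  act (repr (rmul x y)) phi p = act (repr x) (act (repr y) phi) p.
Proof.
by rewrite -[x in rmul x _]reprK -[y in rmul _ y]reprK -pi_mul act_repr.
Qed.

Lemma rhoD a b phi p : rho (a + b) phi p = rho a phi p + rho b phi p.
Proof. by rewrite /rho act_reprD mulrDl addrACA. Qed.

Lemma rhoZ k a phi p : rho (k *: a) phi p = k * rho a phi p.
Proof. by rewrite /rho act_reprZ mulrDr mulrA. Qed.

Lemma rhoM a b phi p : rho (a * b) phi p = rho a (rho b phi) p.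
Proof.
rewrite /rho /= !act_reprD !act_reprZ act_reprM actD actZ mulrDr mulrA.
by rewrite -!addrA; congr (_ + _).
Qed.

Lemma vtx_neq0 (v : vertex E) : vtx K v <> 0.
Proof.
move=> /(congr1 (fun a => rho a (fun=> 1) (v, 0%N, 0))).
by rewrite rho_pi rho0 /= (asboolT erefl) // => /eqP; rewrite oner_eq0.
Qed.

(** Each ghost raises the degree by one, so applying the polynomial to the indicator [phi i] of
    degree [i] and reading the result at degree 0 extracts the coefficient of ['X^i]. *)
Lemma horner_alg_vtx_inj (f : edge E) (p : {poly K}) : esource f = erange f ->
  horner_alg (gho K f) p * vtx K (esource f) = 0 -> p = 0.
Proof.
move=> sf; set v := esource f; set F := gho K f => p0.
pose phi (i : nat) (q : point) : K := (q.2 == i%:Z)%:R.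
have rhoX k i m d :
    rho (F ^+ k * vtx K v) (phi i) (v, m, d) = (d + k%:Z == i%:Z)%:R.
  elim: k m d => [|k IH] m d.
    by rewrite expr0 mul1r rho_pi /= (asboolT erefl) // addr0.
  rewrite exprS -mulrA rhoM rho_pi /= (asboolT sf) IH.
  by rewrite -addrA -intS.
apply/polyP => i; rewrite coef0.
have := congr1 (fun a => rho a (phi i) (v, 0%N, 0)) p0; rewrite rho0.
rewrite -[p in horner_alg F p]coefK poly_def raddf_sum mulr_suml /=.
rewrite (big_morph (fun a => rho a (phi i) (v, 0%N, 0))
           (id1 := 0) (op1 := +%R)); last 2 first.
- by move=> a b; rewrite rhoD.
- exact: rho0.
under eq_bigr do
  rewrite linearZ rmorphXn /= horner_algX -!scalerAl mul1r rhoZ rhoX.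
case: (ltnP i (size p)) => [ip|ip]; last by rewrite nth_default.
rewrite (bigD1 (Ordinal ip)) //= add0r eqxx mulr1 big1 ?addr0 // => j /negbTE.
by rewrite add0r eqz_nat -val_eqE /= => ->; rewrite mulr0.
Qed.

End BoundaryRepresentation.

(** * Consequences of the representation for row-finite graphs *)

Section Faithfulness.
Variables (K : fieldType) (E : digraph).
Hypothesis finE : row_finite E.
Notation L := (leavitt K E).
Notation A := (unitization K E).
Notation vtx := (@vtx K E).
Notation edg := (@edg K E).
Notation gho := (@gho K E).
Notation embed := (@embed K E).

Lemma row_enum : exists out : vertex E -> seq {classic edge E},
  (forall v, uniq (out v)) /\ (forall v e, e \in out v <-> esource e = v).
Proof.
have enum v : exists s : seq {classic edge E},
    uniq s /\ forall e, e \in s <-> esource e = v.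
  have /(@finite_seqP {classic edge E})[s sE] := finE v.
  exists (undup s); split; first exact: undup_uniq.
  move=> e; rewrite mem_undup.
  have -> // : (esource e = v) = ((e : {classic edge E}) \in s :> bool).
  exact: (congr1 (fun B : set (edge E) => B e) sE).
have [out outP] := choice enum.
by exists out; split => v; have [] := outP v.
Qed.

Lemma leavitt_vtx_neq0 v : vtx v <> 0.
Proof. by have [out [uo mo]] := row_enum; exact: (vtx_neq0 uo mo). Qed.

Lemma horner_gho_inj f p : esource f = erange f ->
  horner_alg (gho f) p * vtx (esource f) = 0 -> p = 0.
Proof.
by have [out [uo mo]] := row_enum; exact: (horner_alg_vtx_inj uo mo).
Qed.

End Faithfulness.

(** * Corners at loops *)

Section Loops.
Variables (K : fieldType) (E : digraph).
Hypothesis finE : row_finite E.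
Notation L := (leavitt K E).
Notation A := (unitization K E).
Notation vtx := (@vtx K E).
Notation edg := (@edg K E).
Notation gho := (@gho K E).
Notation embed := (@embed K E).

Section Loop.
Variables (f : edge E) (v : vertex E).
Hypotheses (sf : esource f = v) (rf : erange f = v).
Local Notation F := (gho f).
(** [horner_alg] sends constants to multiples of the adjoined unit; the factor [vtx v] brings the
    value back into the corner at [v], whose unit is [vtx v]. *)
Local Notation ev p := (horner_alg F p * vtx v).

Lemma horner_gho_eq0 p : ev p = 0 -> p = 0.
Proof. by rewrite -sf; apply: (horner_gho_inj finE); rewrite sf rf. Qed.

Lemma vtx_gho_loop : vtx v * F = F.
Proof. by rewrite -rf range_gho. Qed.

Lemma gho_vtx_loop : F * vtx v = F.
Proof. by rewrite -sf gho_source. Qed.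

Lemma horner_ghoM p q :
  horner_alg F (p * q) = horner_alg F p * horner_alg F q.
Proof. exact: rmorphM. Qed.

Lemma evM p q : horner_alg F p * ev q = ev (p * q).
Proof. by rewrite rmorphM mulrA. Qed.

Lemma gho_pow_edg_pow n : F ^+ n * edg f ^+ n * vtx v = vtx v.
Proof.
have vf : GRing.comm (vtx v) (edg f).
  by rewrite /GRing.comm -{1}sf source_edg -rf edg_range.
elim: n => [|n IH]; first by rewrite !mul1r.
rewrite exprSr exprS -!mulrA (mulrA F) gho_edg rf (mulrA (vtx v)) (commrX n vf).
by rewrite -mulrA vtxM mulrA.
Qed.

(** Since [F * edg g = 0], multiplying by [edg g] leaves only the constant term; the powers of
    [edg f] first cancel ghosts and so reach the higher coefficients in turn. *)
Lemma exit_horner_eq0 g p : esource g = v -> g <> f ->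
  (forall k, ev p * (edg f ^+ k * edg g) = 0) -> p = 0.
Proof.
move=> sg gf; have Fg0 : F * edg g = 0 by apply/gho_edg0/nesym.
have g0 : edg g <> 0.
  move=> g0; apply: (@leavitt_vtx_neq0 K E finE (erange g)).
  by rewrite -gho_edg g0 mulr0.
elim/poly_ind: p => [//|p c IH] pk.
have pE : ev (p * 'X + c%:P) = horner_alg F p * F + c *: vtx v.
  rewrite rmorphD /= horner_ghoM horner_algX horner_algC mulrDl -mulrA.
  by rewrite gho_vtx_loop mulr_algl.
have c0 : c = 0.
  have := pk 0%N; rewrite pE expr0 mul1r mulrDl -mulrA Fg0 mulr0 add0r.
  rewrite -scalerAl -sg source_edg => cg; apply: contra_notP g0 => /eqP c0.
  by rewrite -[LHS]scale1r -(mulVf c0) -scalerA cg scaler0.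
rewrite c0 addr0 IH ?mul0r // => k.
(* With the constant term gone, one factor [edg f] cancels the factor [F] split off from
   [p * 'X]. *)
have := pk k.+1; rewrite pE c0 scale0r addr0 exprS -!mulrA (mulrA F) gho_edg rf.
by [].
Qed.

Hypothesis only_entry : forall g, erange g = v -> g = f.

(* Multiplying on the left by a high enough power of [f^*] strips every edge
   that leaves [v] from a monomial, leaving only ghosts entering [v]. *)
Lemma gho_pow_mul x : exists N p, horner_alg F 'X^N * vtx v * embed x = ev p.
Proof.
move: x; pose P a := exists N p, horner_alg F 'X^N * vtx v * a = ev p.
apply: (@leavitt_ind K E P) => [w|g|g||a b|x y|k a].
- exists 0%N; rewrite expr0 rmorph1 mul1r.
  have [<-|vw] := pselect (v = w).
    by exists 1; rewrite rmorph1 mul1r vtxM.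
  by exists 0; rewrite rmorph0 mul0r vtxM0.
- have [sg|sg] := pselect (v = esource g); last first.
    by exists 0%N, 0; rewrite rmorph0 mul0r -mulrA vtx_edg0 // mulr0.
  exists 1%N; rewrite expr1 horner_algX gho_vtx_loop.
  have [<-|fg] := pselect (f = g).
    by exists 1; rewrite rmorph1 mul1r gho_edg rf.
  by exists 0; rewrite rmorph0 mul0r gho_edg0.
- exists 0%N; rewrite expr0 rmorph1 mul1r.
  have [rg|rg] := pselect (v = erange g); last first.
    by exists 0; rewrite rmorph0 mul0r vtx_gho0.
  rewrite (only_entry (esym rg)); exists 'X.
  by rewrite horner_algX vtx_gho_loop gho_vtx_loop.
- by exists 0%N, 0; rewrite rmorph0 mulr0 mul0r.
- move=> [N [p pE]] [M [q qE]]; exists (N + M)%N, ('X^M * p + 'X^N * q).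
  rewrite mulrDr rmorphD /= mulrDl -!evM -pE -qE !mulrA -!horner_ghoM.
  by rewrite exprD ['X^M * _]mulrC.
(* ['X^N] turns [x] into [p]; then ['X^M] commutes past [p] and turns [y] into [q]. *)
- move=> [N [p pE]] [M [q qE]]; exists (N + M)%N, (p * q).
  rewrite -evM -qE addnC exprD horner_ghoM -!mulrA (mulrA (vtx v)).
  rewrite (mulrA (horner_alg F 'X^N)) (mulrA (horner_alg F 'X^N)) pE.
  by rewrite !mulrA -!horner_ghoM mulrC.
- move=> [N [p pE]]; exists N, (k%:P * p).
  by rewrite -scalerAr pE -evM horner_algC mulr_algl.
Qed.

End Loop.

(** * The corner at an isolated loop as a Laurent polynomial ring *)

Section Isolated.
Variables (f : edge E) (v : vertex E).
Hypotheses (sf : esource f = v) (rf : erange f = v).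
Hypothesis iso : forall g, esource g = v \/ erange g = v -> g = f.
Local Notation F := (gho f).
Local Notation ev p := (horner_alg F p * vtx v).

Lemma isolated_edg_gho : edg f * gho f = vtx v.
Proof.
rewrite (@cuntz_krieger2 K E v [:: (f : {classic edge E})]) //.
- by rewrite big_seq1.
- by case; exists f.
- move=> e; rewrite inE; split => [/eqP->//|ev].
  by apply/eqP/iso; left.
Qed.

Lemma isolated_vtxC x : vtx v * embed x = embed x * vtx v.
Proof.
move: x; apply: (@leavitt_ind K E (fun a => vtx v * a = a * vtx v))
  => [w|g|g||a b|x y|k a].
- have [->//|vw] := pselect (v = w).
  by rewrite !vtxM0 // => /esym.
- have [->|gf] := pselect (g = f).
    by rewrite -{1}sf source_edg -rf edg_range.
  rewrite vtx_edg0 ?edg_vtx0 // => ?; apply: gf; apply: iso; by [left|right].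
- have [->|gf] := pselect (g = f).
    by rewrite -{1}rf range_gho -sf gho_source.
  rewrite vtx_gho0 ?gho_vtx0 // => ?; apply: gf; apply: iso; by [left|right].
- by rewrite mulr0 mul0r.
- by move=> Ha Hb; rewrite mulrDr mulrDl Ha Hb.
- by move=> Hx Hy; rewrite mulrA Hx -mulrA Hy mulrA.
- by move=> Ha; rewrite -scalerAr Ha -scalerAl.
Qed.

Lemma isolated_edg_gho_pow n : edg f ^+ n * F ^+ n * vtx v = vtx v.
Proof.
have vF : GRing.comm (vtx v) F.
  by rewrite /GRing.comm -{1}rf range_gho -sf gho_source.
elim: n => [|n IH]; first by rewrite !mul1r.
rewrite exprSr exprS -!mulrA (mulrA (edg f)) isolated_edg_gho.
by rewrite (mulrA (vtx v)) (commrX n vF) -mulrA vtxM mulrA.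
Qed.

(** This writes [vtx v * embed x] as a fraction with numerator [p] and denominator ['X^N]; the
    numerator detects zero because [edg f ^+ N] inverts [F ^+ N] in the corner. *)
Lemma isolated_pow x : exists N p,
  horner_alg F 'X^N * (vtx v * embed x) = ev p /\
  (p = 0 -> vtx v * embed x = 0).
Proof.
have [|N [p pE]] := gho_pow_mul sf rf _ x.
  by move=> g rg; apply: iso; right.
exists N, p; rewrite mulrA; split=> // p0.
move: pE; rewrite p0 rmorph0 mul0r rmorphXn /= horner_algX => p1.
by rewrite -(isolated_edg_gho_pow N) -!mulrA (mulrA (F ^+ N)) p1 mulr0.
Qed.

(** The product has numerator [p * q], and [{poly K}] is a domain. *)
Lemma isolated_domain x y : vtx v * (embed x * embed y) = 0 ->
  vtx v * embed x = 0 \/ vtx v * embed y = 0.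
Proof.
have [N [p [pE p0]]] := isolated_pow x; have [M [q [qE q0]]] := isolated_pow y.
move=> xy0; suff : p * q = 0.
  by move/eqP; rewrite mulf_eq0 => /orP[/eqP/p0|/eqP/q0]; [left|right].
apply: (horner_gho_eq0 sf rf); rewrite -(evM f v) -qE mulrA -horner_ghoM.
rewrite mulrC horner_ghoM -mulrA.
by rewrite (mulrA (horner_alg F p)) -pE -!mulrA xy0 !mulr0.
Qed.

Lemma isolated_nonunit x : vtx v * ((vtx v + F) * embed x) <> vtx v.
Proof.
have [M [q [qE _]]] := isolated_pow x => xv.
(* Clearing denominators makes [1 + 'X] divide a power of ['X]; at [-1] the left side vanishes and
   the right side is a sign. *)
have /(congr1 (fun r : {poly K} => r.[-1])) : (1 + 'X) * q = 'X^M.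
  apply/eqP; rewrite -subr_eq0; apply/eqP/(horner_gho_eq0 sf rf).
  rewrite rmorphB /= mulrBl -(evM f v) -qE mulrA -horner_ghoM.
  rewrite mulrC horner_ghoM -mulrA -mulrBr.
  have -> : horner_alg F (1 + 'X) * (vtx v * embed x) = vtx v.
    rewrite -[RHS]xv rmorphD rmorph1 /= horner_algX !mulrA mulrDl mulrDr.
    by rewrite mul1r vtxM (gho_vtx_loop sf) (vtx_gho_loop rf).
  by rewrite subrr mulr0.
rewrite hornerM hornerD hornerC hornerX subrr mul0r hornerXn => /esym/eqP.
by rewrite signr_eq0.
Qed.

End Isolated.

End Loops.

(** * The ring-theoretic invariant *)

(** For a central idempotent, [rmul e (rmul x y)] is the product of [rmul e x] and [rmul e y], so
    conditions on the ring [e R] can quantify over all of [R]. The last clause asks for a nonzero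
    element of [e R] with no right inverse there. *)
Definition domain_summand (R : rngType) (e : R) : Prop :=
  [/\ e <> 0, rmul e e = e, forall x, rmul e x = rmul x e,
      forall x y, rmul e (rmul x y) = 0 -> rmul e x = 0 \/ rmul e y = 0 &
      exists x, rmul e x <> 0 /\ forall y, rmul e (rmul x y) <> e].

Lemma domain_summand_morph (R S : rngType) (g : R -> S) (e : R) :
    bijective g -> {morph g : x y / x + y} ->
    {morph g : x y / rmul x y} ->
  domain_summand e -> domain_summand (g e).
Proof.
move=> [h gK hK] gD gM [e0 ee ec ed [x [x0 xe]]].
have ginj : injective g := can_inj gK.
have g0 : g 0 = 0 by apply: (addrI (g 0)); rewrite -gD !addr0.
split; first by rewrite -g0 => /ginj.
- by rewrite -gM ee.
- by move=> y; rewrite -(hK y) -!gM ec.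
- move=> y z; rewrite -(hK y) -(hK z) -!gM -g0 => /ginj /ed[] ->.
    by left.
  by right.
- exists (g x); split; first by rewrite -gM -g0 => /ginj.
  by move=> y; rewrite -(hK y) -!gM => /ginj; exact: xe.
Qed.

Local Open Scope classical_set_scope.
Local Open Scope card_scope.

(** * Isolated loops correspond to domain summands *)

Section Summands.
Variables (K : fieldType) (E : digraph).
Hypothesis finE : row_finite E.
Notation L := (leavitt K E).
Notation A := (unitization K E).
Notation vtx := (@vtx K E).
Notation edg := (@edg K E).
Notation gho := (@gho K E).
Notation embed := (@embed K E).

Lemma isolated_summand f :
  isolated_loop f -> domain_summand (\pi_L (LVertex (esource f))).
Proof.
move=> [v [sf rf iso]]; rewrite sf; split.
- by move/(congr1 embed); exact: (leavitt_vtx_neq0 finE).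
- by apply: embed_inj; rewrite embedM; exact: vtxM.
- move=> x; apply: embed_inj; rewrite !embedM.
  exact: (isolated_vtxC sf rf iso).
- move=> x y /(congr1 embed); rewrite !embedM.
  move=> /(isolated_domain finE sf rf iso).
  by case=> xy; [left|right]; apply: embed_inj; rewrite embedM.
(* The witness is the Laurent polynomial [1 + 'X], which is nonzero but not invertible. *)
- exists (\pi_L (LVertex v) + \pi_L (LGhost f)); split.
    move/(congr1 embed); rewrite embedM embedD -/(vtx v) -/(gho f).
    rewrite mulrDr vtxM (vtx_gho_loop K rf) => vf0.
    have /(horner_gho_eq0 finE sf rf) : horner_alg (gho f) (1 + 'X) * vtx v = 0.
      rewrite rmorphD rmorph1 /= horner_algX mulrDl mul1r.
      by rewrite (gho_vtx_loop K sf).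
    move/(congr1 (fun p : {poly K} => p`_0)); apply/eqP.
    by rewrite coefD coef1 coefX coef0 addr0 oner_eq0.
  move=> y /(congr1 embed); rewrite !embedM embedD.
  exact: (isolated_nonunit finE sf rf iso).
Qed.

Lemma summand_isolated (e : L) : domain_summand e ->
  exists2 f, isolated_loop f & e = \pi_L (LVertex (esource f)).
Proof.
move=> [e0 ee ec ed [x0 [x00 xe]]]; pose a := embed e.
have aC b : a * b = b * a by exact: comm_unitization.
have aa : a * a = a by rewrite -embedM ee.
have a0 : a <> 0 by move/embed_eq0.
have aD x y : a * (embed x * embed y) = 0 -> a * embed x = 0 \/ a * embed y = 0.
  rewrite -!embedM => /embed_eq0/ed.
  by case=> xy; [left|right]; rewrite xy.
have [v av0] : exists v, a * vtx v <> 0.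
  apply: contrapT => /forallNP av0.
  have av w : a * vtx w = 0 by exact: contrapT (av0 w).
  case: a0; rewrite -aa.
  (* Every generator has a vertex as left factor, so [a] would annihilate all of [L], itself
     included. *)
  have : forall x, a * embed x = 0.
    apply: (@leavitt_ind K E (fun b => a * b = 0)) => [//|g|g||b c|x y|k b].
    - by rewrite -source_edg mulrA av mul0r.
    - by rewrite -range_gho mulrA av mul0r.
    - by rewrite mulr0.
    - by move=> ab ac; rewrite mulrDr ab ac addr0.
    - by move=> ab _; rewrite mulrA ab mul0r.
    - by move=> ab; rewrite -scalerAr ab scaler0.
  exact.
have av : a * vtx v = a.
  pose u : L := \pi_L (LVertex v).
  (* In the domain [e L], the idempotent [a * vtx v] is orthogonal to its complement and nonzero, so
     the complement vanishes. *)
  have : a * (embed u * embed (e - rmul e u)) = 0.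
    rewrite embedD embedN embedM -/(vtx v) -/a.
    have va : vtx v * a = a * vtx v by [].
    by rewrite mulrBr va mulrA va -mulrA vtxM subrr mulr0.
  case/aD => [//|]; rewrite embedD embedN embedM -/(vtx v) -/a mulrBr mulrA aa.
  by move/eqP; rewrite subr_eq0 => /eqP.
have aw w : w <> v -> a * vtx w = 0.
  by move=> /nesym wv; rewrite -av -mulrA vtxM0 ?mulr0.
have into h : erange h = v -> esource h = v.
  move=> rh; apply: contrapT => sh; apply: a0.
  (* Inserting [gho h * edg h] for [vtx v], centrality moves [a] next to [vtx (esource h)], which it
     kills. *)
  rewrite -av -rh -gho_edg -source_edg !mulrA aC -!mulrA (mulrA a) aw //.
  by rewrite !mul0r mulr0.
have out g : erange g <> v -> a * edg g = 0.
  by move=> rg; rewrite aC -edg_range -mulrA -aC aw // mulr0.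
have agho g : erange g <> v -> a * gho g = 0.
  by move=> rg; rewrite -range_gho mulrA aw // mul0r.
have aedg g : esource g <> v -> a * edg g = 0.
  by move=> rg; rewrite -source_edg mulrA aw // mul0r.
have [sink|nsink] := pselect (is_sink v).
  exfalso.
  have nos g : esource g <> v by move=> sg; apply: sink; exists g.
  have nor g : erange g <> v by move=> /into/nos.
  (* No edge leaves or enters [v], so [a] kills all edges and ghosts; then [x0] is invertible in
     [e L], against [xe]. *)
  have scal x : exists k, a * embed x = k *: a.
    move: x; apply: (@leavitt_ind K E (fun b => exists k, a * b = k *: a))
      => [w|g|g||b c|x y|k b].
    - have [->|/aw ->] := pselect (w = v); first by exists 1; rewrite scale1r.
      by exists 0; rewrite scale0r.
    - by exists 0; rewrite scale0r aedg.
    - by exists 0; rewrite scale0r agho.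
    - by exists 0; rewrite scale0r mulr0.
    - by move=> [k ab] [l ac]; exists (k + l); rewrite mulrDr ab ac scalerDl.
    - move=> [k ab] [l ac]; exists (k * l).
      by rewrite mulrA ab -scalerAl ac scalerA.
    - by move=> [l ab]; exists (k * l); rewrite -scalerAr ab scalerA.
  have [k kE] := scal x0; have k0 : k != 0.
    apply/eqP => k0; apply: x00; apply: embed_inj.
    by rewrite embedM kE k0 scale0r.
  apply: (xe (k^-1 *: e)); apply: embed_inj; rewrite !embedM embedZ mulrA kE.
  by rewrite -scalerAl -scalerAr -/a aa scalerA mulfV // scale1r.
have [f sf af] : exists2 f, esource f = v & a * edg f <> 0.
  have [enu [uo mo]] := row_enum finE.
  apply: contrapT => /forall2NP nof; apply: a0.
  rewrite -av (cuntz_krieger2 K nsink (uo v) (mo v)) mulr_sumr big1_seq // => g.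
  move=> /andP[_ /mo gv]; have [//|/contrapT ag] := nof g.
  by rewrite mulrA ag mul0r.
have rf : erange f = v by apply: contrapT => /out.
have aexit g : g <> f -> a * edg g = 0.
  move=> gf; have [sg|/aedg//] := pselect (esource g = v).
  (* Distinct edges give orthogonal idempotents [edg f * gho f] and [edg g * gho g], so the domain
     [e L] kills one of them; [af] excludes the first. *)
  have : a * (embed (rmul (\pi_L (LEdge f)) (\pi_L (LGhost f))) *
     embed (rmul (\pi_L (LEdge g)) (\pi_L (LGhost g)))) = 0.
    rewrite !embedM -/(edg f) -/(gho f) -/(edg g) -/(gho g).
    by rewrite -mulrA (mulrA (gho f)) gho_edg0 ?mul0r ?mulr0 //; exact: nesym.
  case/aD; rewrite !embedM -/(edg f) -/(gho f) -/(edg g) -/(gho g).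
    move/(congr1 ( *%R^~ (edg f))); rewrite mul0r -!mulrA gho_edg edg_range.
    by move/af.
  by move/(congr1 ( *%R^~ (edg g))); rewrite mul0r -!mulrA gho_edg edg_range.
have entry g : erange g = v -> g = f.
  move=> rg; apply: contrapT => /aexit ag; apply: a0.
  by rewrite -av -rg -gho_edg mulrA (aC (gho g)) -mulrA ag mulr0.
have noexit g : esource g = v -> g = f.
  move=> sg; apply: contrapT => gf; apply: a0.
  have [N [p pE]] := gho_pow_mul sf rf entry e.
  have va : vtx v * a = a by rewrite -aC.
  have {}pE : gho f ^+ N * a = horner_alg (gho f) p * vtx v.
    by rewrite -pE rmorphXn /= horner_algX -mulrA va.
  have p0 : p = 0.
    apply: (exit_horner_eq0 finE sf rf sg gf) => k.
    (* The polynomial contains the central factor [a], which kills the exit [g]. *)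
    by rewrite -pE -mulrA aC -mulrA -(aC (edg g)) aexit // !mulr0.
  (* Writing [vtx v] as [F ^+ N * edg f ^+ N * vtx v] exhibits [F ^+ N * a], now zero, as a factor
     of [a]. *)
  rewrite -av -(gho_pow_edg_pow K sf rf N) !mulrA aC -!mulrA.
  rewrite !mulrA pE p0 rmorph0.
  by rewrite !mul0r.
have isof : isolated_loop f by exists v; split=> // g [/noexit|/entry].
exists f => //; rewrite sf; apply: embed_inj; rewrite -/(vtx v) -/a.
have iso g : esource g = v \/ erange g = v -> g = f by case=> [/noexit|/entry].
have va : vtx v * a = a by rewrite -aC.
(* As [f] is isolated, the corner at [v] is itself a domain, so its nonzero idempotent [a] equals
   [vtx v]. *)
have : vtx v * (a * embed (\pi_L (LVertex v) - e)) = 0.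
  by rewrite embedD embedN -/(vtx v) -/a mulrBr av aa subrr mulr0.
case/(isolated_domain finE sf rf iso); first by rewrite -/a va => /a0.
rewrite embedD embedN -/(vtx v) -/a mulrBr vtxM va => /eqP.
by rewrite subr_eq0 => /eqP.
Qed.
(** The bijection sends a loop to its base vertex; it is injective because an isolated loop is the
    only edge at its base and distinct vertices are orthogonal and nonzero. *)
Lemma card_isolated_loops : [set f : edge E | isolated_loop f] #=
  [set e : L | domain_summand e].
Proof.
pose u (f : edge E) : L := \pi_L (LVertex (esource f)).
have -> : [set e : L | domain_summand e] = u @` [set f | isolated_loop f].
  apply/seteqP; split=> [e /summand_isolated[f fi ->]|e [f fi <-]].
    by exists f.
  exact: isolated_summand.
rewrite card_eq_sym; apply: inj_card_eq => f g; rewrite !inE.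
move=> -[v [sf rf fi]] _ /(congr1 embed).
rewrite -/(vtx (esource f)) -/(vtx (esource g)) sf => ufg.
have [sg|sg] := pselect (esource g = v); first by apply/esym/fi; left.
by case: (@leavitt_vtx_neq0 K E finE v); rewrite -vtxM {2}ufg vtxM0 // => /esym.
Qed.

End Summands.

Lemma card_domain_summand (R S : rngType) : rng_isomorphic R S ->
  [set e : R | domain_summand e] #= [set e : S | domain_summand e].
Proof.
move=> [g [gbij gD gM]]; have [h gK hK] := gbij.
have hbij : bijective h by exists g.
have hD : {morph h : x y / x + y}.
  by move=> x y; apply: (can_inj gK); rewrite gD !hK.
have hM : {morph h : x y / rmul x y}.
  by move=> x y; apply: (can_inj gK); rewrite gM !hK.
have -> : [set e : S | domain_summand e] = g @` [set e | domain_summand e].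
  apply/seteqP; split=> [e de|e [e' de <-]].
    by exists (h e) => //; exact: domain_summand_morph.
  exact: domain_summand_morph.
by rewrite card_eq_sym; apply: inj_card_eq => x y _ _ /(can_inj gK).
Qed.

Theorem corollary4p4 (K : fieldType) (E F : digraph)
    (hE : row_finite E) (hF : row_finite F)
    (hEF : rng_isomorphic (leavitt K E) (leavitt K F)) :
  forall n : nat,
    [set f : edge E | isolated_loop f] #= `I_n <->
    [set f : edge F | isolated_loop f] #= `I_n.
Proof.
have EF : [set f : edge E | isolated_loop f] #=
          [set f : edge F | isolated_loop f].
  apply: card_eq_trans (card_isolated_loops K hE) _.
  apply: card_eq_trans (card_domain_summand hEF) _.
  by rewrite card_eq_sym; exact: card_isolated_loops.
move=> n; split; last exact: card_eq_trans.
by apply: card_eq_trans; rewrite card_eq_sym.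
Qed.
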